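(* Let $j$ be the jump intensity of a constant speed random walk $\mathbb{P}$ on the square lattice $\mathbb{Z}^2$. Assume that for some $\lambda>0$: $$\forall x\in\mathbb{Z}^2,\ i\in\{1,2\}:\quad \Phi_j(\mathbf{e}_{x,i})\le\lambda^2,$$ and $$\forall x\in\mathbb{Z}^2:\quad \Phi_j(\mathbf{e}_{x,2})\,\Phi_j(\mathbf{e}_{x,1})\le\Phi_j(\mathbf{f}_x)\le\Phi_j(\mathbf{e}_{x+v_1,2})\,\Phi_j(\mathbf{e}_{x+v_2,1}).$$ Then for every $x\in\mathbb{Z}^2$ and every $t\in(0,1)$, $$\log\mathbb{P}^{xx}\Big(d\big(X_t,\mathbb{E}_{\mathbb{P}^{xx}}(X_t)\big)\ge R\Big)\le-2R\log R+\big[\log(4\lambda^2t(1-t))+2\big]R+o(R),$$ where $o(R)$ denotes a function $g$ of $R>0$ with $\lim_{R\to+\infty}g(R)/R=0$.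
   Context: Square lattice: $v_1=(1,0)$, $v_2=(0,1)$; the vertex set is $\mathbb{Z}^2$ and the set $\mathcal{A}$ of arcs consists of all $(x\to x\pm v_i)$, $x\in\mathbb{Z}^2$, $i\in\{1,2\}$. Closed walks of length two: $\mathbf{e}_{x,1}=(x\to x+v_1\to x)$, $\mathbf{e}_{x,2}=(x\to x+v_2\to x)$. Clockwise oriented faces: $\mathbf{f}_x=(x\to x+v_2\to x+v_1+v_2\to x+v_1\to x)$. Jump intensity: a function $j:\mathcal{A}\to(0,\infty)$, $j(z\to z')$ being the rate of jumping from $z$ to $z'$. Constant speed means that there is $v>0$ with $\sum_{z':z\to z'}j(z\to z')=v$ for all $z$. For a closed walk $\mathbf{c}=(x_0\to x_1\to\cdots\to x_n=x_0)$ its closed walk characteristic is $\Phi_j(\mathbf{c})=\prod_{i=0}^{n-1}j(x_i\to x_{i+1})$. $(X_t)_{0\le t\le1}$ is the canonical process, $\mathbb{P}^{x}$ the law of the continuous-time random walk with intensity $j$ on $[0,1]$ started at $x$, and $\mathbb{P}^{xx}=\mathbb{P}^x(\cdot|X_1=x)$ its bridge. $d$ is the graph distance, i.e. the $\ell^1$ distance, which makes sense for the (possibly non-lattice) point $\mathbb{E}_{\mathbb{P}^{xx}}(X_t)\in\mathbb{R}^2$. By convention $\log0=-\infty$. *)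

(* Defs.v *)
From mathcomp Require Import all_boot all_order all_algebra.
From mathcomp Require Import all_classical all_reals all_analysis.
Set Implicit Arguments.
Unset Strict Implicit.
Unset Printing Implicit Defensive.
Import Order.TTheory GRing.Theory Num.Theory.
Import numFieldNormedType.Exports.
Local Open Scope classical_set_scope.
Local Open Scope ring_scope.

Definition v1 : int * int := (1, 0).
Definition v2 : int * int := (0, 1).

Definition nbrs (z : int * int) : seq (int * int) :=
  [:: z + v1; z - v1; z + v2; z - v2].

Definition arc (z z' : int * int) : bool := z' \in nbrs z.

(* Closed walks are lists [:: x_0; x_1; ...; x_n] of vertices, with the return
   to x_n = x_0 written out. *)
Definition e1 (x : int * int) : seq (int * int) := [:: x; x + v1; x].
Definition e2 (x : int * int) : seq (int * int) := [:: x; x + v2; x].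
Definition face (x : int * int) : seq (int * int) :=
  [:: x; x + v2; x + v1 + v2; x + v1; x].

Section Intensity.
Context {R : realType}.

(* A function on the arcs is represented by a function of pairs of vertices,
   whose values at pairs that are not arcs are never used. *)
Definition jump_intensity (j : int * int -> int * int -> R) : Prop :=
  forall z z', arc z z' -> 0 < j z z'.

Definition constant_speed (j : int * int -> int * int -> R) : Prop :=
  exists2 v : R, 0 < v & forall z, \sum_(z' <- nbrs z) j z z' = v.

Definition Phi (j : int * int -> int * int -> R) (c : seq (int * int)) : R :=
  \prod_(a <- zip c (behead c)) j a.1 a.2.

Definition generator (j : int * int -> int * int -> R)
    (f : int * int -> R) (z : int * int) : R :=
  \sum_(z' <- nbrs z) j z z' * (f z' - f z).

(* The kernel of the semigroup exp (t L), where L is the generator; the series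
   converges when the rates are bounded, in particular at constant speed. *)
Definition transition (j : int * int -> int * int -> R) (t : R)
    (z y : int * int) : R :=
  limn (series (fun n : nat =>
    t ^+ n / n`!%:R *
    iter n (generator j) (fun z' : int * int => (z' == y)%:R) z)).

(* fdd j u z [:: (t_1, y_1); ...; (t_n, y_n)] is the probability that the walk
   in z at time u is in y_i at time t_i for each i, for u <= t_1 <= ... <= t_n. *)
Fixpoint fdd (j : int * int -> int * int -> R) (u : R) (z : int * int)
    (s : seq (R * (int * int))) : R :=
  if s is (t, y) :: s' then transition j (t - u) z y * fdd j t y s' else 1.

End Intensity.

Section Process.
Context {R : realType} {d : measure_display} {Omega : measurableType d}.

(* Time is in R for convenience; only the times in [0, 1] matter. *)
Record process := Process {
  process_fun :> R -> Omega -> int * int;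
  measurable_process :
    forall (t : R) (y : int * int),
      measurable [set w : Omega | process_fun t w = y] }.

(* Right-continuity with left limits on [0, 1], in a discrete state space. *)
Definition cadlag (X : process) : Prop :=
  forall w : Omega,
    (forall t : R, 0 <= t < 1 -> \forall s \near t^'+, X s w = X t w) /\
    (forall t : R, 0 < t <= 1 ->
       exists z, \forall s \near t^'-, X s w = z).

(* The case s = [:: (0, x)] of the second condition gives X_0 = x a.s. *)
Definition random_walk_from (j : int * int -> int * int -> R) (x : int * int)
    (P : probability Omega R) (X : process) : Prop :=
  cadlag X /\
  forall s : seq (R * (int * int)),
    path <=%R 0 (unzip1 s) -> all (fun t => t <= 1) (unzip1 s) ->
    P [set w : Omega | forall a, a \in s -> X a.1 w = a.2] = (fdd j 0 x s)%:E.

(* The conditional probability P (. | X_1 = x). *)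
Definition bridge (P : probability Omega R) (X : process) (x : int * int) :
    probability Omega R :=
  mnormalize (mrestr P (measurable_process X 1 x)) P.

Definition mean (Q : probability Omega R) (X : process) (t : R) : R * R :=
  (fine 'E_Q[fun w => (X t w).1%:~R], fine 'E_Q[fun w => (X t w).2%:~R]).

Definition dist_l1 (z : int * int) (m : R * R) : R :=
  `|z.1%:~R - m.1| + `|z.2%:~R - m.2|.

End Process.
Arguments process R {d} Omega.

(* Main.v *)
Require Import Defs.
From mathcomp Require Import all_boot all_order all_algebra.
From mathcomp Require Import all_classical all_reals all_analysis.
From mathcomp Require Import ring lra zify.
Set Implicit Arguments.
Unset Strict Implicit.
Unset Printing Implicit Defensive.
Import Order.TTheory GRing.Theory Num.Theory.
Import numFieldNormedType.Exports.
Local Open Scope classical_set_scope.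
Local Open Scope ring_scope.

(** The mean of the bridge at time [t] enters only through its distance [c] to
    the starting point: the event of distance at least [r] from the mean forces
    a distance at least [r - c] from [x], and this shift costs [2 c ln r],
    which is [o(r)].

    Let [W k z y] be the sum, over the walks of [k] steps from [z] to [y], of
    the products of the intensities along the walk.  At constant speed [v] the
    kernel of the walk is [exp (- v t) \sum_k t ^ k / k! W k z y]
    ([transitionE]), so the law of the bridge is governed by the products
    [W k x y * W l y x], that is, by closed walks of [k + l] steps.

    The hypotheses on the faces say that a walk that turns at the lower left
    corner of a face does not lose weight when it is made to turn at the upper
    right corner instead ([push_corner1], [push_corner2]).  Pushing a closed walk up
    and to the right in this way flattens it into backtracks, so that its weight
    is at most [lambda] to the power its length.  This is used in its dual form:
    there is a potential [h > 0], the largest weight of an up-right path towards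
    a far corner, such that [j z z' * h z' <= lambda * h z] ([potential_step]).
    Up to the factor [h z / h z'], which cancels along a closed walk, the
    intensities are thus bounded by those of the simple walk of rate [lambda].

    It remains to make the Chernoff bound of the simple walk.  Given a direction
    [u = +- z_1 +- z_2], multiplying [h] by [exp (a u)] gives a function that
    one jump increases by a factor at most
    [tilt lambda a = 2 lambda (exp a + exp (- a))] ([jumps_tilted]).  Tilting the
    way out by [a] and the way back by [b] bounds the exponential moment of order
    [a + b] of [u (X_t) - u x] under the bridge by
    [exp (t tilt lambda a + (1 - t) tilt lambda b)] ([loop_moment]).  The four
    directions together give the tail ([bridge_tail]), and the choice
    [exp a = r / (2 lambda t)], [exp b = r / (2 lambda (1 - t))], up to a bounded
    shift of [r], turns the exponent into
    [2 r - r (2 ln r - ln (4 lambda ^ 2 t (1 - t)))]. *)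

(** * Quadrants of the lattice *)

Lemma coordE (z : int * int) :
  ((((z + v1).1 = z.1 + 1)%R * ((z + v1).2 = z.2)%R *
   ((z - v1).1 = z.1 - 1)%R * ((z - v1).2 = z.2)%R *
   ((z + v2).1 = z.1)%R * ((z + v2).2 = z.2 + 1)%R *
   ((z - v2).1 = z.1)%R * ((z - v2).2 = z.2 - 1)%R))%type.
Proof. by do ![split]; rewrite /= ?oppr0 ?addr0. Qed.

Definition height (c z : int * int) : int := (c.1 - z.1) + (c.2 - z.2).

(** From such a point, [n] jumps do not leave the quadrant below [c], where the
    potential of corner [c] is controlled. *)
Definition deep (c : int * int) (n : nat) (z : int * int) : bool :=
  (z.1 + n%:Z <= c.1) && (z.2 + n%:Z <= c.2).

Lemma deepS c n z : deep c n.+1 z ->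
  [/\ deep c n (z + v1), deep c n (z - v1), deep c n (z + v2) & deep c n (z - v2)].
Proof. by rewrite /deep => ?; rewrite !coordE; split; lia. Qed.

Lemma deepW c n m z : (n <= m)%N -> deep c m z -> deep c n z.
Proof. by rewrite /deep; lia. Qed.

(** * A potential that bounds the intensities *)

Section Potential.
Variables (R : realType) (j : int * int -> int * int -> R) (lambda : R).
Hypotheses (hj : jump_intensity j) (hlambda : 0 < lambda).
Hypothesis he : forall x : int * int,
  Phi j (e1 x) <= lambda ^+ 2 /\ Phi j (e2 x) <= lambda ^+ 2.
Hypothesis hf : forall x : int * int,
  Phi j (e2 x) * Phi j (e1 x) <= Phi j (face x)
    <= Phi j (e2 (x + v1)) * Phi j (e1 (x + v2)).

Lemma intensity_gt0 z :
  [/\ 0 < j z (z + v1), 0 < j z (z - v1), 0 < j z (z + v2) & 0 < j z (z - v2)].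
Proof. by split; apply: hj; rewrite /Defs.arc !inE eqxx ?orbT. Qed.

Lemma backtrack_le z :
  [/\ j z (z + v1) * j (z + v1) z <= lambda ^+ 2,
      j z (z - v1) * j (z - v1) z <= lambda ^+ 2,
      j z (z + v2) * j (z + v2) z <= lambda ^+ 2 &
      j z (z - v2) * j (z - v2) z <= lambda ^+ 2].
Proof.
have Phi1 x : j x (x + v1) * j (x + v1) x <= lambda ^+ 2.
  by have [+ _] := he x; rewrite /Phi /= !big_cons big_nil mulr1.
have Phi2 x : j x (x + v2) * j (x + v2) x <= lambda ^+ 2.
  by have [_] := he x; rewrite /Phi /= !big_cons big_nil mulr1.
split=> //.
- by rewrite mulrC; have := Phi1 (z - v1); rewrite subrK.
- by rewrite mulrC; have := Phi2 (z - v2); rewrite subrK.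
Qed.

(** The upper bound on the face at [z - v1], divided by the rates of the two
    arcs common to both sides: of the two ways around the face, the one through
    the upper right corner is at least as heavy. *)
Lemma push_corner1 z :
  j z (z - v1) * j (z - v1) (z - v1 + v2) <=
  j z (z + v2) * j (z + v2) (z + v2 - v1).
Proof.
have /andP[_] := hf (z - v1).
rewrite /Phi /= !big_cons !big_nil /= !mulr1 subrK.
have E : z - v1 + v2 + v1 = z + v2 by rewrite addrAC subrK.
rewrite E.
have -> : z + v2 - v1 = z - v1 + v2 by rewrite addrAC.
have [_ _ z2 _] := intensity_gt0 z.
have [_ _ _ z2'] := intensity_gt0 (z + v2).
have [z1 _ _ _] := intensity_gt0 (z - v1 + v2).
rewrite addrK in z2'; rewrite E in z1.
set A := j z (z - v1); set B := j (z - v1) _.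
set C := j (z - v1 + v2) _ in z1 *; set D := j (z + v2) z in z2' *.
rewrite (_ : B * _ = (A * B) * (C * D)); last by ring.
rewrite [X in _ <= X -> _](_ : _ = (j z (z + v2) * j (z + v2) (z - v1 + v2)) * (C * D));
  last by ring.
by rewrite ler_pM2r // mulr_gt0.
Qed.

(** The same comparison around the face at [z - v2], in the opposite sense of
    rotation; it comes from the lower bound on the face. *)
Lemma push_corner2 z :
  j z (z - v2) * j (z - v2) (z - v2 + v1) <=
  j z (z + v1) * j (z + v1) (z + v1 - v2).
Proof.
have /andP[+ _] := hf (z - v2).
rewrite /Phi /= !big_cons !big_nil /= !mulr1 subrK.
have E : z - v2 + v1 + v2 = z + v1 by rewrite addrAC subrK.
rewrite E.
have -> : z + v1 - v2 = z - v2 + v1 by rewrite addrAC.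
have [_ _ z1 _] := intensity_gt0 (z - v2).
have [_ z2 _ _] := intensity_gt0 (z - v2 + v1).
rewrite addrK in z2; rewrite subrK in z1.
set A := j z (z - v2); set B := j (z - v2) (_ + v1).
set C := j (z - v2) z in z1 *; set D := j (z - v2 + v1) _ in z2 *.
rewrite (_ : C * _ * _ = (A * B) * (C * D)); last by ring.
rewrite [X in _ <= X -> _](_ : _ = (j z (z + v1) * j (z + v1) (z - v2 + v1)) * (C * D));
  last by ring.
by rewrite ler_pM2r // mulr_gt0.
Qed.

(** The largest weight, over the up-right paths of [k] steps from [z] to [c], of
    the product of the ratios [j / lambda] along the path (and [0] if there is no
    such path). *)
Fixpoint ascent (c : int * int) (k : nat) (z : int * int) : R :=
  if k is k'.+1 then
    Num.max (j z (z + v1) * ascent c k' (z + v1))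
            (j z (z + v2) * ascent c k' (z + v2)) / lambda
  else (z == c)%:R.

Lemma ascentS c k z : ascent c k.+1 z =
  Num.max (j z (z + v1) * ascent c k (z + v1))
          (j z (z + v2) * ascent c k (z + v2)) / lambda.
Proof. by []. Qed.

Arguments ascent : simpl never.

Lemma ascent_ge0 c k z : 0 <= ascent c k z.
Proof.
elim: k z => [|k IH] z; rewrite ?ascentS; first exact: ler0n.
have [j1 _ _ _] := intensity_gt0 z.
by rewrite divr_ge0 ?(ltW hlambda) // le_max mulr_ge0 ?IH // ltW.
Qed.

Lemma ascent_out (c z : int * int) k :
  (c.1 < z.1) || (c.2 < z.2) -> ascent c k z = 0.
Proof.
elim: k z => [|k IH] z cz; rewrite ?ascentS.
  rewrite /ascent; by case: eqP => // zc; move: cz; rewrite zc !ltxx.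
by rewrite !IH ?mulr0 ?maxxx ?mul0r ?coordE //; lia.
Qed.

Lemma ascent_gt0 (c z : int * int) (k : nat) :
  z.1 <= c.1 -> z.2 <= c.2 -> height c z = k -> 0 < ascent c k z.
Proof.
rewrite /height; elim: k z => [|k IH] z le1 le2 hk; rewrite ?ascentS.
  suff -> : z = c by rewrite /ascent eqxx ltr01.
  by apply/eqP; rewrite -pair_eqE /pair_eq /=; apply/andP; split; lia.
have [j1 _ j2 _] := intensity_gt0 z.
rewrite divr_gt0 // lt_max; have [lt1|ge1] := ltP z.1 c.1.
  by rewrite mulr_gt0 // IH ?coordE; lia.
by apply/orP; right; rewrite mulr_gt0 // IH ?coordE; lia.
Qed.

Lemma ascent_up c k z :
  j z (z + v1) * ascent c k (z + v1) <= lambda * ascent c k.+1 z /\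
  j z (z + v2) * ascent c k (z + v2) <= lambda * ascent c k.+1 z.
Proof.
by rewrite ascentS [lambda * _]mulrC divfK ?gt_eqF // !le_max !lexx orbT.
Qed.

Lemma ler_max_step (a A B W : R) : 0 <= a ->
  a * A <= lambda * (lambda * W) -> a * B <= lambda * (lambda * W) ->
  a * (Num.max A B / lambda) <= lambda * W.
Proof.
move=> a0 hA hB; rewrite mulrA ler_pdivrMr // maxr_pMr // ge_max.
by rewrite [lambda * W * _]mulrC hA.
Qed.

(** A step left or down followed by an ascent to [c] is no better than the direct
    ascent.  If the ascent begins by undoing the step, the two steps form a
    backtrack, of weight at most [lambda ^ 2].  Otherwise they turn at the lower
    left corner of a face; turning at the upper right corner instead begins with
    an ascending step, after which the induction hypothesis applies.  When the
    upper right corner is outside of the quadrant of [c], so is the rest of the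
    path, and its weight vanishes. *)
Lemma ascent_down (c z : int * int) (k : nat) :
  z.1 <= c.1 -> z.2 <= c.2 -> height c z = k ->
  j z (z - v1) * ascent c k.+1 (z - v1) <= lambda * ascent c k z /\
  j z (z - v2) * ascent c k.+1 (z - v2) <= lambda * ascent c k z.
Proof.
elim: k z => [|k IH] z le1 le2 hk.
all: have [j1 j1' j2 j2'] := intensity_gt0 z.
all: have [_ b1 _ b2] := backtrack_le z.
all: have back (a b w : R) : 0 <= w -> a * b <= lambda ^+ 2 ->
    a * (b * w) <= lambda * (lambda * w)
  by move=> w0 ab; rewrite !mulrA -expr2 ler_wpM2r.
all: have ge0 (w : R) : 0 <= w -> 0 <= lambda * (lambda * w)
  by move=> ?; rewrite !mulr_ge0 // ltW.
all: split; rewrite ascentS; apply: ler_max_step; rewrite ?subrK ?(ltW j1') ?(ltW j2') //;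
  try by apply: back => //; exact: ascent_ge0.
- by rewrite ascent_out ?mulr0 ?ge0 ?ascent_ge0 // !coordE; move: hk; rewrite /height; lia.
- by rewrite ascent_out ?mulr0 ?ge0 ?ascent_ge0 // !coordE; move: hk; rewrite /height; lia.
- have [lt2|ge2] := ltP z.2 c.2; last first.
    by rewrite ascent_out ?mulr0 ?ge0 ?ascent_ge0 // !coordE; lia.
  have [||| IH1 _] := IH (z + v2); rewrite ?coordE //; [lia|by move: hk; rewrite /height !coordE; lia|].
  have [_ up] := ascent_up c k z.
  rewrite mulrA (le_trans (ler_wpM2r (ascent_ge0 _ _ _) (push_corner1 z))) //.
  rewrite -mulrA; have -> : z - v1 + v2 = z + v2 - v1 by rewrite addrAC.
  apply: le_trans (ler_wpM2l (ltW j2) IH1) _.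
  by rewrite mulrCA ler_wpM2l // ltW.
- have [lt2|ge2] := ltP z.1 c.1; last first.
    by rewrite ascent_out ?mulr0 ?ge0 ?ascent_ge0 // !coordE; lia.
  have [||| _ IH2] := IH (z + v1); rewrite ?coordE //; [lia|by move: hk; rewrite /height !coordE; lia|].
  have [up _] := ascent_up c k z.
  rewrite mulrA (le_trans (ler_wpM2r (ascent_ge0 _ _ _) (push_corner2 z))) //.
  rewrite -mulrA; have -> : z - v2 + v1 = z + v1 - v2 by rewrite addrAC.
  apply: le_trans (ler_wpM2l (ltW j1) IH2) _.
  by rewrite mulrCA ler_wpM2l // ltW.
Qed.

(** All up-right paths from [z] to [c] have [height c z] steps, so this is the
    largest weight among all of them. *)
Definition potential (c z : int * int) : R := ascent c (absz (height c z)) z.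

Lemma potential_ge0 c z : 0 <= potential c z.
Proof. exact: ascent_ge0. Qed.

Lemma potential_gt0 c z : deep c 0 z -> 0 < potential c z.
Proof. by move=> /andP[? ?]; apply: ascent_gt0; rewrite /height; lia. Qed.

Lemma potential_step c z : deep c 1 z ->
  [/\ j z (z + v1) * potential c (z + v1) <= lambda * potential c z,
      j z (z - v1) * potential c (z - v1) <= lambda * potential c z,
      j z (z + v2) * potential c (z + v2) <= lambda * potential c z &
      j z (z - v2) * potential c (z - v2) <= lambda * potential c z].
Proof.
move=> dz; rewrite /potential.
have -> : (absz (height c (z - v1))) = (absz (height c z)).+1.
  by move: dz; rewrite /height /deep !coordE; lia.
have -> : (absz (height c (z - v2))) = (absz (height c z)).+1.
  by move: dz; rewrite /height /deep !coordE; lia.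
have -> : (absz (height c (z + v1))) = (absz (height c z)).-1.
  by move: dz; rewrite /height /deep !coordE; lia.
have -> : (absz (height c (z + v2))) = (absz (height c z)).-1.
  by move: dz; rewrite /height /deep !coordE; lia.
have [up1 up2] := ascent_up c (absz (height c z)).-1 z.
rewrite prednK in up1 up2; last by move: dz; rewrite /height /deep; lia.
have [||| dn1 dn2] := @ascent_down c z (absz (height c z)); last by split.
all: by move: dz; rewrite /height /deep; lia.
Qed.

End Potential.

(** * Weights of walks *)

Definition jumps {R : realType} (j : int * int -> int * int -> R)
    (f : int * int -> R) (z : int * int) : R :=
  \sum_(z' <- nbrs z) j z z' * f z'.

(** The sum, over the walks of [n] steps from [z] to [y], of the product of the
    intensities along the walk. *)
Definition walks {R : realType} (j : int * int -> int * int -> R) (n : nat)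
    (z y : int * int) : R :=
  iter n (jumps j) (fun z' => (z' == y)%:R) z.

Section Jumps.
Variables (R : realType) (j : int * int -> int * int -> R).
Hypothesis hj : jump_intensity j.

Lemma jumpsE f z : jumps j f z =
  j z (z + v1) * f (z + v1) + j z (z - v1) * f (z - v1) +
  j z (z + v2) * f (z + v2) + j z (z - v2) * f (z - v2).
Proof. by rewrite /jumps /nbrs !big_cons big_nil addr0 !addrA. Qed.

Lemma jumpsZ a f : jumps j (fun z => a * f z) = (fun z => a * jumps j f z).
Proof.
by apply/funext => z; rewrite /jumps mulr_sumr; apply: eq_bigr => y _; rewrite mulrCA.
Qed.

Lemma jumps_sum I (r : seq I) (f : I -> int * int -> R) :
  jumps j (fun z => \sum_(i <- r) f i z) = (fun z => \sum_(i <- r) jumps j (f i) z).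
Proof.
apply/funext => z; rewrite /jumps exchange_big /=; apply: eq_bigr => y _.
by rewrite mulr_sumr.
Qed.

Lemma iter_jumpsZ n a f :
  iter n (jumps j) (fun z => a * f z) = (fun z => a * iter n (jumps j) f z).
Proof. by elim: n => //= n ->; rewrite jumpsZ. Qed.

Lemma iter_jumps_sum n I (r : seq I) (f : I -> int * int -> R) :
  iter n (jumps j) (fun z => \sum_(i <- r) f i z) =
  (fun z => \sum_(i <- r) iter n (jumps j) (f i) z).
Proof. by elim: n => //= n ->; rewrite jumps_sum. Qed.

Lemma walks_ge0 n z y : 0 <= walks j n z y.
Proof.
rewrite /walks; elim: n z => [|n IH] z; first exact: ler0n.
have [? ? ? ?] := intensity_gt0 hj z.
by rewrite iterS jumpsE !addr_ge0 // mulr_ge0 ?IH ?ltW.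
Qed.

(** A potential is controlled in a quadrant only; a comparison in this region
    suffices, since [n] jumps from [z] do not leave it. *)
Lemma iter_jumps_le (c z : int * int) n m (f g : int * int -> R) :
  (forall z', deep c m z' -> f z' <= g z') -> deep c (n + m) z ->
  iter n (jumps j) f z <= iter n (jumps j) g z.
Proof.
move=> fg; elim: n z => [|n IH] z dz; first exact: fg.
have [? ? ? ?] := intensity_gt0 hj z.
have [? ? ? ?] := deepS dz.
by rewrite !iterS !jumpsE !lerD // ler_pM2l // IH.
Qed.

End Jumps.

(** * Exponential moments of closed walks *)

(** The [l^1] norm is the maximum of these four linear forms. *)
Definition signed_sum (R : realType) (s : bool * bool) (z : int * int) : R :=
  (-1) ^+ s.1 * z.1%:~R + (-1) ^+ s.2 * z.2%:~R.

(** For the simple walk of rate [lambda], the eigenvalue of [jumps] at the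
    exponential of [a] times a signed sum. *)
Definition tilt (R : realType) (lambda a : R) : R :=
  2 * lambda * (expR a + expR (- a)).

Section WalkBound.
Variables (R : realType) (j : int * int -> int * int -> R) (lambda : R).
Hypotheses (hj : jump_intensity j) (hlambda : 0 < lambda).
Hypothesis he : forall x : int * int,
  Phi j (e1 x) <= lambda ^+ 2 /\ Phi j (e2 x) <= lambda ^+ 2.
Hypothesis hf : forall x : int * int,
  Phi j (e2 x) * Phi j (e1 x) <= Phi j (face x)
    <= Phi j (e2 (x + v1)) * Phi j (e1 (x + v2)).
Variables (c : int * int) (s : bool * bool).

Notation h := (potential j lambda c).

Lemma tilt_ge0 a : 0 <= tilt lambda a.
Proof. by rewrite mulr_ge0 ?addr_ge0 ?expR_ge0 ?mulr_ge0 ?ltW. Qed.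

Lemma tiltN a : tilt lambda (- a) = tilt lambda a.
Proof. by rewrite /tilt opprK [expR (- a) + _]addrC. Qed.

(** The potential bounds each arc by the constant [lambda], after which this is
    the computation of the eigenvalue for the simple walk. *)
Lemma jumps_tilted a z : deep c 1 z ->
  jumps j (fun z => h z * expR (a * signed_sum R s z)) z <=
  tilt lambda a * (h z * expR (a * signed_sum R s z)).
Proof.
move=> dz; have [p1 p2 p3 p4] := potential_step hj hlambda he hf dz.
rewrite jumpsE.
have step (w : int * int) b : j z w * h w <= lambda * h z ->
    signed_sum R s w = signed_sum R s z + b ->
    j z w * (h w * expR (a * signed_sum R s w)) <=
    lambda * expR (a * b) * (h z * expR (a * signed_sum R s z)).
  move=> jh ->; rewrite mulrDr expRD.
  rewrite mulrA [X in _ <= X](_ : _ = (lambda * h z) * (expR (a * signed_sum R s z) * expR (a * b))).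
    by rewrite ler_wpM2r // mulr_ge0 ?expR_ge0.
  by ring.
have signed_sumD b (w : int * int) : w.1 = z.1 + b.1 -> w.2 = z.2 + b.2 ->
    signed_sum R s w = signed_sum R s z + signed_sum R s b.
  move=> w1 w2; rewrite /signed_sum w1 w2 !rmorphD /=; ring.
have step' (w b : int * int) := @step w (signed_sum R s b).
have q1 := step' (z + v1) v1 p1 (signed_sumD v1 (z + v1) erefl erefl).
have q2 := step' (z - v1) (- v1) p2 (signed_sumD (- v1) (z - v1) erefl erefl).
have q3 := step' (z + v2) v2 p3 (signed_sumD v2 (z + v2) erefl erefl).
have q4 := step' (z - v2) (- v2) p4 (signed_sumD (- v2) (z - v2) erefl erefl).
apply: (le_trans (lerD (lerD (lerD q1 q2) q3) q4)).
rewrite -!mulrDl -!mulrDr ler_wpM2r //.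
  by rewrite mulr_ge0 ?expR_ge0 // potential_ge0.
rewrite /tilt [2 * _]mulrC -mulrA ler_pM2l // le_eqVlt; apply/orP; left; apply/eqP.
have f1 : signed_sum R s v1 = (-1) ^+ s.1 by rewrite /signed_sum /= mulr1 mulr0 addr0.
have f2 : signed_sum R s v2 = (-1) ^+ s.2 by rewrite /signed_sum /= mulr1 mulr0 add0r.
have fN w : signed_sum R s (- w) = - signed_sum R s w.
  by rewrite /signed_sum /= !rmorphN /= !mulrN opprD.
rewrite !fN f1 f2.
by case: s => -[] -[] /=; rewrite ?expr1 ?expr0 ?mulrN ?opprK ?mulr1; ring.
Qed.

Lemma iter_jumps_tilted a n z : deep c n z ->
  iter n (jumps j) (fun z => h z * expR (a * signed_sum R s z)) z <=
  tilt lambda a ^+ n * (h z * expR (a * signed_sum R s z)).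
Proof.
elim: n z => [|n IH] z dz; first by rewrite expr0 mul1r.
rewrite iterSr.
pose g z' := tilt lambda a * (h z' * expR (a * signed_sum R s z')).
apply: (@le_trans _ _ (iter n (jumps j) g z)).
  apply: (@iter_jumps_le _ _ hj c z n 1); last by rewrite addn1.
  by move=> z'; exact: jumps_tilted.
rewrite /g iter_jumpsZ exprS -mulrA ler_wpM2l ?tilt_ge0 // IH //.
exact: deepW dz.
Qed.

(** The tilted potential dominates its own restriction to the point [x]. *)
Lemma walks_tilted a n x z : deep c n z -> deep c 0 x ->
  h x * expR (a * signed_sum R s x) * walks j n z x <=
  tilt lambda a ^+ n * (h z * expR (a * signed_sum R s z)).
Proof.
move=> dz dx; apply: le_trans (iter_jumps_tilted a dz).
have H := @iter_jumpsZ R j n (h x * expR (a * signed_sum R s x)) (fun z' => (z' == x)%:R).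
rewrite /walks -(congr1 (fun F => F z) H).
apply: (@iter_jumps_le _ _ hj c z n 0); last by rewrite addn0.
move=> z' _; case: eqP => [->|_]; first by rewrite mulr1.
by rewrite mulr0 mulr_ge0 ?expR_ge0 ?potential_ge0.
Qed.

End WalkBound.

Section ClosedWalkBound.
Variables (R : realType) (j : int * int -> int * int -> R) (lambda : R).
Hypotheses (hj : jump_intensity j) (hlambda : 0 < lambda).
Hypothesis he : forall x : int * int,
  Phi j (e1 x) <= lambda ^+ 2 /\ Phi j (e2 x) <= lambda ^+ 2.
Hypothesis hf : forall x : int * int,
  Phi j (e2 x) * Phi j (e1 x) <= Phi j (face x)
    <= Phi j (e2 (x + v1)) * Phi j (e1 (x + v2)).

(** The way back from [y] to [x] is bounded by [h y / h x], tilted by [- b]; the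
    sum over [y] of the ways out, with the weights [h y] tilted by [a], is again
    bounded by [h x].  The potential cancels, whatever its corner is: any corner
    far enough from [x] for walks of [k + l] steps will do. *)
Lemma closed_walks_tilted (x : int * int) s a b k l (F : seq (int * int)) :
  uniq F ->
  \sum_(y <- F) expR ((a + b) * (signed_sum R s y - signed_sum R s x)) *
    (walks j k x y * walks j l y x) <= tilt lambda a ^+ k * tilt lambda b ^+ l.
Proof.
move=> uF; pose c := (x.1 + (k + l)%:Z, x.2 + (k + l)%:Z) : int * int.
have dx : deep c (k + l) x by rewrite /deep /c /= !lexx.
set h := potential j lambda c.
have hx : 0 < h x by apply: potential_gt0 => //; exact: deepW dx.
set ex := expR (a * signed_sum R s x).
have Xx : 0 < h x * ex by rewrite mulr_gt0 ?expR_gt0.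
pose f y := expR ((a + b) * (signed_sum R s y - signed_sum R s x)) * walks j l y x.
have -> : \sum_(y <- F) expR ((a + b) * (signed_sum R s y - signed_sum R s x)) *
    (walks j k x y * walks j l y x) =
    iter k (jumps j) (fun z => \sum_(y <- F) f y * (z == y)%:R) x.
  rewrite (@iter_jumps_sum R j k _ F (fun y z => f y * (z == y)%:R)).
  apply: eq_bigr => y _.
  rewrite (@iter_jumpsZ R j k (f y) (fun z => (z == y)%:R)) -/(walks j k x y) /f.
  by ring.
rewrite -(ler_pM2r Xx) mulrC.
have := iter_jumps_tilted hj hlambda he hf s a (deepW (leq_addr l k) dx).
move/(ler_wpM2l (exprn_ge0 l (tilt_ge0 hlambda b))).
rewrite mulrCA mulrA; apply: le_trans.
rewrite -!(congr1 (fun G => G x) (iter_jumpsZ _ _ _ _)).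
apply: (@iter_jumps_le _ _ hj c x k l _ _ _ dx) => z dz /=.
have [zF|zF] := boolP (z \in F); last first.
  rewrite big1_seq ?mulr0; last first.
    move=> y /andP[_ yF]; case: eqP => [zy|_]; last by rewrite mulr0.
    by rewrite zy yF in zF.
  by rewrite mulr_ge0 ?exprn_ge0 ?tilt_ge0 // mulr_ge0 ?expR_ge0 ?potential_ge0.
rewrite (bigD1_seq z) //= eqxx mulr1 big1 ?addr0; last first.
  by move=> y /negbTE; rewrite eq_sym => ->; rewrite mulr0.
have := walks_tilted hj hlambda he hf s (- b) dz (deepW (leq0n _) dx).
set ux := signed_sum R s x; set uz := signed_sum R s z.
move/(ler_wpM2r (expR_ge0 (a * ux + (a + b) * (uz - ux) + b * ux))).
rewrite tiltN -/h.
have -> : h x * expR (- b * ux) * walks j l z x *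
    expR (a * ux + (a + b) * (uz - ux) + b * ux) = h x * ex * f z.
  rewrite /f /ex -/ux -/uz 2!expRD mulNr expRN.
  have := expR_gt0 (b * ux); move: (expR (b * ux)) => e e0.
  by field; rewrite gt_eqF.
have -> // : tilt lambda b ^+ l * (h z * expR (- b * uz)) *
    expR (a * ux + (a + b) * (uz - ux) + b * ux) =
    tilt lambda b ^+ l * (h z * expR (a * uz)).
rewrite -!mulrA -expRD; do 2 congr (_ * _).
by congr expR; ring.
Qed.

End ClosedWalkBound.

(** * Cauchy products of series *)

Section CauchyProduct.
Variable R : realType.
Implicit Types a b : R ^nat.

(** In the sum of index [n], either [n - k] is large and [b] is small, or [k] is
    large and the terms are bounded by a tail of the series of [a]. *)
Lemma cvg_convolution0 a b (A : R) :
  (forall n, 0 <= a n) -> series a @ \oo --> A -> b @ \oo --> (0 : R) ->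
  \sum_(k < n) a k * b (n - k)%N @[n --> \oo] --> (0 : R).
Proof.
move=> a0 aA b0.
have leA n : series a n <= A.
  rewrite -(cvg_lim _ aA) //; apply: nondecreasing_cvgn_le; last by apply/cvg_ex; exists A.
  by apply/nondecreasing_seqP => m; rewrite seriesSr lerDl.
have [M M0 bM] : exists2 M : R, 0 <= M & forall m, `|b m| <= M.
  have /cvg_seq_bounded /pinfty_ex_gt0[M M0 bM] : cvgn b by apply/cvg_ex; exists 0.
  by exists M; [exact: ltW|move=> m; exact: bM].
have A0 : 0 <= A by apply: le_trans (leA 0%N); rewrite seriesEord /= big_ord0.
apply/cvgr0Pnorm_lt => e e0.
pose eta := e / (A + M + 1).
have den0 : 0 < A + M + 1 by rewrite ltr_wpDl ?addr_ge0.
have eta0 : 0 < eta by rewrite divr_gt0.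
have [N1 _ hN1] : \forall m \near \oo, `|b m| < eta by move/cvgr0Pnorm_lt : b0; apply.
have [N2 _ hN2] : \forall m \near \oo, `|A - series a m| < eta.
  by move/cvgrPdist_lt : aA; apply.
exists (N1 + N2)%N => // n /= hn.
have term (k : 'I_n) : true -> `|a k * b (n - k)%N| <= a k * eta + (N2 <= k)%:R * (a k * M).
  move=> _; rewrite normrM (ger0_norm (a0 k)); case: leqP => [_|kN2].
    by rewrite mul1r (le_trans (ler_wpM2l (a0 k) (bM _))) // lerDr mulr_ge0 // ltW.
  rewrite mul0r addr0 ler_wpM2l //; apply/ltW/hN1 => /=.
  by have := ltn_ord k; lia.
apply: (le_lt_trans (ler_norm_sum _ _ _)).
apply: (le_lt_trans (ler_sum _ term)).
rewrite big_split /= -mulr_suml.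
have -> : \sum_(i < n) (N2 <= i)%:R * (a i * M) = (series a n - series a N2) * M.
  rewrite !seriesEnat /= -(big_mkord xpredT (fun i => (N2 <= i)%:R * (a i * M))).
  have N2n : (N2 <= n)%N by lia.
  rewrite (big_cat_nat (leq0n N2) N2n) /=.
  rewrite (big_cat_nat (leq0n N2) N2n (F := a)) /= [X in (X - _) * _]addrC addrK.
  rewrite big_nat_cond big1 ?add0r; last first.
    by move=> i /andP[/andP[_ iN2] _]; rewrite leqNgt iN2 mul0r.
  rewrite mulr_suml big_nat_cond [RHS]big_nat_cond; apply: eq_bigr => i /andP[/andP[-> _] _].
  by rewrite mul1r.
have h1 : (\sum_(i < n) a i) * eta <= A * eta.
  by rewrite ler_wpM2r ?(ltW eta0) //; have := leA n; rewrite seriesEord.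
have h2 : (series a n - series a N2) * M <= eta * M.
  rewrite ler_wpM2r //; have := hN2 N2 (leqnn _).
  rewrite ger0_norm ?subr_ge0 ?leA // => /ltW; apply: le_trans.
  by rewrite lerB // leA.
apply: (le_lt_trans (lerD h1 h2)).
rewrite [A * _]mulrC -mulrDr /eta mulrAC ltr_pdivrMr // ltr_pM2l //.
by rewrite ltrDl.
Qed.

(** The partial sums are the convolution of [a] with the partial sums of [b]. *)
Lemma cauchy_product a b (A B : R) :
  (forall n, 0 <= a n) -> series a @ \oo --> A -> series b @ \oo --> B ->
  series (fun n => \sum_(k < n.+1) a k * b (n - k)%N) @ \oo --> A * B.
Proof.
move=> a0 aA bB.
have -> : series (fun n => \sum_(k < n.+1) a k * b (n - k)%N) =
    (fun n => series a n * B + \sum_(k < n) a k * (series b (n - k)%N - B)).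
  apply/funext => n; rewrite seriesEord.
  transitivity (\sum_(k < n) a k * series b (n - k)%N); last first.
    have -> : series a n = \sum_(k < n) a k by rewrite seriesEord.
    rewrite mulr_suml -big_split /=; apply: eq_bigr => k _.
    by rewrite -mulrDr addrC subrK.
  rewrite /=; elim: n => [|n IH]; first by rewrite !big_ord0.
  rewrite big_ord_recr /= IH.
  transitivity (\sum_(k < n.+1) (a k * series b (n - k)%N + a k * b (n - k)%N)).
    rewrite big_split /= [X in _ = X + _]big_ord_recr /= subnn.
    by rewrite [series b 0%N](_ : _ = 0) ?mulr0 ?addr0 // seriesEord /= big_ord0.
  apply: eq_bigr => k _; rewrite -mulrDr -seriesSr subSn //.
  by have := ltn_ord k; lia.
rewrite -[A * B]addr0; apply: cvgD; first exact: cvgMl.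
apply: (@cvg_convolution0 a (fun m => series b m - B) A) => //.
rewrite -(subrr B); apply: cvgB => //; exact: cvg_cst.
Qed.

End CauchyProduct.

(** * The kernel of the walk in terms of weights of walks *)

Section Transition.
Variables (R : realType) (j : int * int -> int * int -> R) (v : R).
Hypotheses (hj : jump_intensity j) (v0 : 0 < v).
Hypothesis hv : forall z, \sum_(z' <- nbrs z) j z z' = v.

Lemma generatorE f z : generator j f z = jumps j f z - v * f z.
Proof.
rewrite /generator /jumps -(hv z) mulr_suml -sumrB.
by apply: eq_bigr => y _; rewrite mulrBr.
Qed.

(** The binomial formula for the power of [jumps j - v], in the form of the
    product of the exponential series of [jumps j] and of [- v]. *)
Lemma iter_generator n f z : iter n (generator j) f z / n`!%:R =
  \sum_(k < n.+1) iter k (jumps j) f z / k`!%:R * exp_coeff (- v) (n - k)%N.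
Proof.
have fact0 m : m`!%:R != 0 :> R by rewrite pnatr_eq0 -lt0n fact_gt0.
elim: n z => [|n IH] z.
  by rewrite big_ord_recl big_ord0 /exp_coeff /= !divr1 expr0 mulr1 addr0.
(* As n + 1 = k + (n + 1 - k), the coefficient of order n + 1 is obtained from
   those of order n by raising either index. *)
apply: (@mulfI _ (n.+1%:R)); first by rewrite pnatr_eq0.
transitivity (\sum_(k < n.+1)
    (iter k.+1 (jumps j) f z / k`!%:R * exp_coeff (- v) (n - k)%N -
     v * (iter k (jumps j) f z / k`!%:R * exp_coeff (- v) (n - k)%N))).
  rewrite sumrB -mulr_sumr -IH iterS generatorE factS natrM invfM.
  rewrite mulrCA [_ * (_ / _)]mulrA divff ?pnatr_eq0 // mul1r mulrBl mulrA; congr (_ - _).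
  rewrite /jumps mulr_suml.
  transitivity (\sum_(y <- nbrs z) j z y * (iter n (generator j) f y / n`!%:R)).
    by apply: eq_bigr => y _; rewrite mulrA.
  under eq_bigr do rewrite IH mulr_sumr.
  rewrite exchange_big /=; apply: eq_bigr => k _.
  by rewrite /jumps !mulr_suml; apply: eq_bigr => y _; rewrite !mulrA.
rewrite mulr_sumr.
transitivity (\sum_(k < n.+2)
   (k%:R * (iter k (jumps j) f z / k`!%:R * exp_coeff (- v) (n.+1 - k)%N) +
    (n.+1 - k)%:R * (iter k (jumps j) f z / k`!%:R * exp_coeff (- v) (n.+1 - k)%N))).
  rewrite !big_split /= [in RHS]big_ord_recl /= mul0r add0r.
  rewrite [X in _ = _ + X]big_ord_recr /= subnn mul0r addr0; congr (_ + _).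
    apply: eq_bigr => k _; rewrite /bump /= add1n subSS factS natrM.
    have := fact0 k; have : k.+1%:R != 0 :> R by rewrite pnatr_eq0.
    by move=> ? ?; field; apply/andP.
  apply: eq_bigr => k _; have kn : (k <= n)%N by rewrite -ltnS.
  rewrite /exp_coeff /= subSn // factS natrM exprS.
  have := fact0 k; have := fact0 (n - k)%N.
  have : (n - k).+1%:R != 0 :> R by rewrite pnatr_eq0.
  by move=> ? ? ?; field; apply/and3P.
apply: eq_bigr => k _; rewrite -mulrDl -natrD subnKC //.
by rewrite -ltnS.
Qed.


Lemma walks_le n z y : walks j n z y <= v ^+ n.
Proof.
rewrite /walks; elim: n z => [|n IH] z.
  by rewrite expr0 /=; case: eqP.
rewrite iterS /jumps exprS -{1}(hv z) mulr_suml.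
rewrite big_seq [X in _ <= X]big_seq.
apply: ler_sum => z' zz'; apply: ler_wpM2l => //.
by rewrite ltW // hj.
Qed.

Definition walk_coeff (t : R) (z y : int * int) : R ^nat :=
  fun k => t ^+ k / k`!%:R * walks j k z y.

Lemma walk_coeff_ge0 t z y k : 0 <= t -> 0 <= walk_coeff t z y k.
Proof. by move=> t0; rewrite mulr_ge0 ?walks_ge0 // divr_ge0 ?exprn_ge0. Qed.

Lemma cvg_walk_coeff t z y : 0 <= t -> cvgn (series (walk_coeff t z y)).
Proof.
move=> t0; apply: (@series_le_cvg _ _ (exp_coeff (v * t))).
- by move=> n; exact: walk_coeff_ge0.
- by move=> n; rewrite exp_coeff_ge0 // mulr_ge0 // ltW.
- move=> n; rewrite /walk_coeff /exp_coeff /= exprMn mulrAC.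
  by rewrite ler_wpM2r // mulrC ler_wpM2r ?exprn_ge0 // walks_le.
- exact: is_cvg_series_exp_coeff.
Qed.

(** Jumps occur at the times of a Poisson process of rate [v], independently of
    the positions: the exponential of [jumps j - v] splits. *)
Lemma transitionE t z y : 0 <= t ->
  transition j t z y = limn (series (walk_coeff t z y)) * expR (- (v * t)).
Proof.
move=> t0; rewrite /transition; apply: cvg_lim => //.
have -> : (fun n => t ^+ n / n`!%:R *
      iter n (generator j) (fun z' => (z' == y)%:R) z) =
    (fun n => \sum_(k < n.+1)
      walk_coeff t z y k * exp_coeff (- (v * t)) (n - k)%N); last first.
  apply: cauchy_product; last exact: is_cvg_series_exp_coeff.
    by move=> n; exact: walk_coeff_ge0.
  exact: cvg_walk_coeff.
apply/funext => n; rewrite mulrAC -mulrA iter_generator mulr_sumr.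
apply: eq_bigr => k _.
have kn : (k <= n)%N by rewrite -ltnS.
rewrite /walk_coeff /exp_coeff /= -mulNr exprMn -/(walks j k z y).
have -> : t ^+ n = t ^+ k * t ^+ (n - k) by rewrite -exprD subnKC.
ring.
Qed.

End Transition.

(** * Exponential moments of loops in continuous time *)

Lemma series_exp_coeff_le (R : realType) (x : R) n : 0 <= x ->
  series (exp_coeff x) n <= expR x.
Proof.
move=> x0; apply: nondecreasing_cvgn_le; last exact: is_cvg_series_exp_coeff.
by apply/nondecreasing_seqP => m; rewrite seriesSr lerDl exp_coeff_ge0.
Qed.

Section Moment.
Variables (R : realType) (j : int * int -> int * int -> R) (v lambda : R).
Hypotheses (hj : jump_intensity j) (v0 : 0 < v).
Hypothesis hv : forall z, \sum_(z' <- nbrs z) j z z' = v.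

Lemma transition_ge0 t z y : 0 <= t -> 0 <= transition j t z y.
Proof.
move=> t0; rewrite (transitionE hj v0 hv z y t0) mulr_ge0 ?expR_ge0 //.
apply: limr_ge; first exact: (cvg_walk_coeff hj v0 hv).
by near=> n; rewrite sumr_ge0 // => i _; exact: walk_coeff_ge0.
Unshelve. all: by end_near. Qed.

(** The walk may stay in place: the walk without steps contributes the term of
    index [0] of the series. *)
Lemma return_ge t x : 0 <= t -> expR (- (v * t)) <= transition j t x x.
Proof.
move=> t0; rewrite (transitionE hj v0 hv x x t0) ler_peMl ?expR_ge0 //.
apply: limr_ge; first exact: (cvg_walk_coeff hj v0 hv).
near=> n.
have /prednK <- : (0 < n)%N by near: n; exists 1%N.
rewrite seriesEord /= big_ord_recl /walk_coeff /walks /= eqxx expr0 divr1 mulr1.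
by rewrite lerDl sumr_ge0 // => i _; exact: (walk_coeff_ge0 hj).
Unshelve. all: by end_near. Qed.

Hypothesis hlambda : 0 < lambda.
Hypothesis he : forall x : int * int,
  Phi j (e1 x) <= lambda ^+ 2 /\ Phi j (e2 x) <= lambda ^+ 2.
Hypothesis hf : forall x : int * int,
  Phi j (e2 x) * Phi j (e1 x) <= Phi j (face x)
    <= Phi j (e2 (x + v1)) * Phi j (e1 (x + v2)).

(** This is [closed_walks_tilted], summed over the numbers of steps of the way out
    and of the way back with the weights of the two exponential series. *)
Lemma loop_moment (x : int * int) s a b t u (F : seq (int * int)) :
  0 <= t -> 0 <= u -> uniq F ->
  \sum_(y <- F) expR ((a + b) * (signed_sum R s y - signed_sum R s x)) *
    (transition j t x y * transition j u y x) <=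
  expR (tilt lambda a * t + tilt lambda b * u - v * (t + u)).
Proof.
move=> t0 u0 uF.
pose wt y := expR ((a + b) * (signed_sum R s y - signed_sum R s x)).
pose A y := series (walk_coeff j t x y).
pose B y := series (walk_coeff j u y x).
have -> : \sum_(y <- F) expR ((a + b) * (signed_sum R s y - signed_sum R s x)) *
    (transition j t x y * transition j u y x) =
    (\sum_(y <- F) wt y * (limn (A y) * limn (B y))) * expR (- (v * (t + u))).
  rewrite mulr_suml; apply: eq_bigr => y _.
  rewrite (transitionE hj v0 hv x y t0) (transitionE hj v0 hv y x u0).
  have -> : expR (- (v * (t + u))) = expR (- (v * t)) * expR (- (v * u)).
    by rewrite -expRD mulrDr opprD.
  by rewrite /wt /A /B; ring.
rewrite expRD ler_wpM2r ?expR_ge0 //.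
have cvgS : (fun n => \sum_(y <- F) wt y * (A y n * B y n)) @ \oo -->
    \sum_(y <- F) wt y * (limn (A y) * limn (B y)).
  elim: F {uF} => [|y F IH].
    by under eq_fun do rewrite big_nil; rewrite big_nil; exact: cvg_cst.
  under eq_fun do rewrite big_cons; rewrite big_cons; apply: cvgD => //.
  apply: cvgMr; apply: cvgM; exact: (cvg_walk_coeff hj v0 hv).
rewrite -(cvg_lim _ cvgS) //; apply: limr_le; first by apply/cvg_ex; eexists; exact: cvgS.
near=> n.
have -> : \sum_(y <- F) wt y * (A y n * B y n) =
  \sum_(k < n) \sum_(l < n) t ^+ k / k`!%:R * (u ^+ l / l`!%:R) *
    \sum_(y <- F) wt y * (walks j k x y * walks j l y x).
  under [RHS]eq_bigr do under eq_bigr do rewrite mulr_sumr.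
  under [RHS]eq_bigr do rewrite exchange_big /=.
  rewrite [RHS]exchange_big /=; apply: eq_bigr => y _.
  rewrite /A /B !seriesEord /= big_distrlr /= mulr_sumr; apply: eq_bigr => k _.
  rewrite mulr_sumr; apply: eq_bigr => l _; rewrite /walk_coeff; ring.
apply: (@le_trans _ _ (series (exp_coeff (tilt lambda a * t)) n *
    series (exp_coeff (tilt lambda b * u)) n)); last first.
  have at0 : 0 <= tilt lambda a * t by rewrite mulr_ge0 ?tilt_ge0.
  have bu0 : 0 <= tilt lambda b * u by rewrite mulr_ge0 ?tilt_ge0.
  rewrite expRD; apply: ler_pM; try exact: series_exp_coeff_le.
    by apply: sumr_ge0 => i _; exact: exp_coeff_ge0.
  by apply: sumr_ge0 => i _; exact: exp_coeff_ge0.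
rewrite !seriesEord /= big_distrlr /=; apply: ler_sum => k _; apply: ler_sum => l _.
have := closed_walks_tilted hj hlambda he hf x s a b k l uF.
move/(ler_wpM2l (_ : 0 <= t ^+ k / k`!%:R * (u ^+ l / l`!%:R))) => /(_ _)/le_trans -> //.
  by rewrite !(mulr_ge0, divr_ge0) ?exprn_ge0.
by rewrite /exp_coeff /= !exprMn le_eqVlt; apply/orP; left; apply/eqP; ring.
Unshelve. all: by end_near. Qed.

End Moment.

(** * Events on the position at a given time *)

Section CountableSum.
Variables (R : realType) (d : measure_display) (Omega : measurableType d).
Variables (P : probability Omega R) (X : process R Omega) (D : set Omega).
Hypothesis mD : measurable D.

Lemma process_event_measurable t (S : pred (int * int)) :
  measurable [set w | S (X t w)].
Proof.
have -> : [set w | S (X t w)] =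
    \bigcup_n (if pickle_inv n is Some y then
                 if S y then [set w | X t w = y] else set0 else set0).
  apply/seteqP; split => w /=.
    by move=> Sw; exists (pickle (X t w)); [|rewrite pickleK_inv Sw].
  move=> [n _]; case: pickle_inv => // y.
  by case: ifP => // Sy /= ->.
apply: bigcup_measurable => n _; case: pickle_inv => // y.
by case: ifP => // _; exact: measurable_process.
Qed.

(** The lattice is countable, so a bound on the finite sums over the points of
    [S] passes to the whole event. *)
Lemma process_event_le t (S : pred (int * int)) (M : R) :
  (forall F : seq (int * int), uniq F -> all S F ->
     (\sum_(y <- F) P ([set w | X t w = y] `&` D) <= M%:E)%E) ->
  (P ([set w | S (X t w)] `&` D) <= M%:E)%E.
Proof.
move=> hM.
pose E n := (if pickle_inv n is Some y then
               if S y then [set w | X t w = y] `&` D else set0 else set0) : set Omega.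
have mE n : measurable (E n).
  rewrite /E; case: pickle_inv => // y; case: ifP => // _.
  by apply: measurableI => //; exact: measurable_process.
have sub : [set w | S (X t w)] `&` D `<=` \bigcup_n E n.
  move=> w [/= Sw Dw]; exists (pickle (X t w)); first by [].
  by rewrite /E pickleK_inv Sw.
apply: (@le_trans _ _ (P (\bigcup_n E n))).
  apply: le_measure; rewrite ?inE //; last exact: bigcup_measurable.
  by apply: measurableI => //; exact: process_event_measurable.
apply: (le_trans (generalized_Boole_inequality _ mE _)); first exact: bigcup_measurable.
apply: lime_le; first by apply: is_cvg_nneseries => n _ _; exact: measure_ge0.
near=> n.
have -> : (\sum_(0 <= i < n) P (E i) =
    \sum_(y <- [seq y <- pmap pickle_inv (index_iota 0 n) | S y])
      P ([set w | X t w = y] `&` D))%E.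
  elim: (index_iota 0 n) => [|i s IH]; first by rewrite !big_nil.
  rewrite big_cons IH /E /=; case: pickle_inv => [y|] /=; last by rewrite measure0 add0e.
  by case: ifP => Sy; rewrite ?big_cons // measure0 add0e.
apply: hM; last exact: filter_all.
apply: filter_uniq; apply: (pmap_uniq (@pickle_invK _)); exact: iota_uniq.
Unshelve. all: by end_near. Qed.

End CountableSum.

(** * The tail of the bridge *)

Section BridgeTail.
Variables (R : realType) (j : int * int -> int * int -> R) (v lambda : R).
Hypotheses (hj : jump_intensity j) (v0 : 0 < v).
Hypothesis hv : forall z, \sum_(z' <- nbrs z) j z z' = v.
Hypothesis hlambda : 0 < lambda.
Hypothesis he : forall x : int * int,
  Phi j (e1 x) <= lambda ^+ 2 /\ Phi j (e2 x) <= lambda ^+ 2.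
Hypothesis hf : forall x : int * int,
  Phi j (e2 x) * Phi j (e1 x) <= Phi j (face x)
    <= Phi j (e2 (x + v1)) * Phi j (e1 (x + v2)).
Variables (x : int * int) (d : measure_display) (Omega : measurableType d).
Variables (P : probability Omega R) (X : process R Omega).
Hypothesis hX : random_walk_from j x P X.
Variable t : R.
Hypothesis ht : 0 < t < 1.

Lemma prob_return : P [set w | X 1 w = x] = (transition j 1 x x)%:E.
Proof.
have [_ /(_ [:: (1, x)])] := hX; rewrite /= ler01 lexx subr0 mulr1 => /(_ erefl erefl) <-.
congr (P _); apply/seteqP; split => w /=.
  by move=> Xw a; rewrite inE => /eqP ->.
by move=> /(_ (1, x)); apply; rewrite inE.
Qed.

Lemma prob_pass y : P ([set w | X t w = y] `&` [set w | X 1 w = x]) =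
  (transition j t x y * transition j (1 - t) y x)%:E.
Proof.
have /andP[t0 t1] := ht.
have [_ /(_ [:: (t, y); (1, x)])] := hX; rewrite /= subr0 mulr1 (ltW t0) (ltW t1) lexx.
move=> /(_ erefl erefl) <-.
congr (P _); apply/seteqP; split => w /=.
  by move=> [Xt X1] a; rewrite !inE => /orP[] /eqP ->.
by move=> H; split; [apply: (H (t, y))|apply: (H (1, x))]; rewrite !inE eqxx ?orbT.
Qed.

(** Markov's inequality for the exponential moments in the four directions.  The
    factor [exp (- v)] of the moments is compensated by the probability of
    return, which is at least [exp (- v)]. *)
Lemma bridge_tail (S : pred (int * int)) a b rho : 0 <= a + b ->
  (forall y, S y -> exists s, rho <= signed_sum R s y - signed_sum R s x) ->
  (bridge P X x [set w | S (X t w)] <=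
    (4 * expR (tilt lambda a * t + tilt lambda b * (1 - t) - (a + b) * rho))%:E)%E.
Proof.
move=> ab hS; have /andP[t0 t1] := ht.
set E := expR _.
have D0 : 0 < transition j 1 x x.
  exact: lt_le_trans (expR_gt0 _) (return_ge hj v0 hv x ler01).
rewrite /bridge /=; rewrite /mnormalize /=.
rewrite /mrestr /= classical_sets.setTI prob_return /= eqe gt_eqF //=.
rewrite -lee_pdivlMr ?invr_gt0 // invrK -EFinM.
apply: process_event_le; first exact: measurable_process.
move=> F uF SF.
under eq_bigr do rewrite prob_pass.
rewrite sumEFin lee_fin.
pose p y := transition j t x y * transition j (1 - t) y x.
pose q s y := expR ((a + b) * (signed_sum R s y - signed_sum R s x)) * p y.
have p0 y : 0 <= p y.
  by rewrite mulr_ge0 // (transition_ge0 hj v0 hv) // ?subr_ge0 ltW.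
apply: (@le_trans _ _ (\sum_(y <- F) \sum_(s : bool * bool) expR (- ((a + b) * rho)) * q s y)).
  rewrite big_seq [X in _ <= X]big_seq; apply: ler_sum => y yF.
  have [s hs] := hS y (allP SF y yF).
  rewrite (bigD1 s) //= ler_wpDr //.
    by rewrite sumr_ge0 // => s' _; rewrite mulr_ge0 ?expR_ge0 // mulr_ge0 ?expR_ge0.
  rewrite mulrA -expRD; apply: ler_peMl; first exact: p0.
  rewrite -expR0 ler_expR.
  by rewrite addrC -mulrBr mulr_ge0 // subr_ge0.
rewrite exchange_big /=.
apply: (@le_trans _ _ (\sum_(s : bool * bool) E * expR (- v))).
  apply: ler_sum => s _; rewrite -mulr_sumr.
  have := loop_moment hj v0 hv hlambda he hf x s a b (ltW t0) (_ : 0 <= 1 - t) uF.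
  rewrite subr_ge0 => /(_ (ltW t1)).
  move/(ler_wpM2l (expR_ge0 (- ((a + b) * rho)))) => /le_trans; apply.
  rewrite -!expRD le_eqVlt; apply/orP; left; apply/eqP; congr expR.
  by ring.
rewrite sumr_const card_prod card_bool -[_ *+ _]mulr_natl mulrA ler_wpM2l //.
  by rewrite mulr_ge0 ?expR_ge0.
by have := return_ge hj v0 hv x (@ler01 R); rewrite mulr1.
Qed.

End BridgeTail.

(** * Choice of the tilt *)

Section Optimisation.
Variable R : realType.

(** By the triangle inequality the left-hand side is at most the [l^1] norm of
    [y - x], which is the signed sum with the signs of its coordinates. *)
Lemma dist_l1_signed (x y : int * int) (m : R * R) :
  exists s, dist_l1 y m - dist_l1 x m <= signed_sum R s y - signed_sum R s x.
Proof.
exists (y.1 < x.1, y.2 < x.2); rewrite /dist_l1 /signed_sum /=.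
have coord (p q : int) (n : R) :
    `|p%:~R - n| - `|q%:~R - n| <= (-1) ^+ (p < q)%R * p%:~R - (-1) ^+ (p < q)%R * q%:~R.
  apply: (le_trans (lerB_dist _ _)).
  rewrite (_ : _ - _ - _ = p%:~R - q%:~R); last by ring.
  rewrite -mulrBr; case: ltP => pq; rewrite ?expr1 ?expr0 ?mul1r ?mulN1r.
    by rewrite ler0_norm // subr_le0 ler_int ltW.
  by rewrite ger0_norm // subr_ge0 ler_int.
have := lerD (coord y.1 x.1 m.1) (coord y.2 x.2 m.2); lra.
Qed.

(** At this tilt the term in [exp a] of [tilt lambda a * t] is [s]; the term in
    [exp (- a)] is bounded. *)
Lemma tilt_ln_le (lambda t s : R) : 0 < lambda -> 0 < t <= 1 -> 2 * lambda <= s ->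
  tilt lambda (ln (s / (2 * lambda * t))) * t <= s + 2 * lambda.
Proof.
move=> l0 /andP[t0 t1] ls.
have s0 : 0 < s by apply: lt_le_trans ls; rewrite mulr_gt0.
have lt0 : 0 < 2 * lambda * t by rewrite !mulr_gt0.
rewrite /tilt expRN lnK ?posrE ?divr_gt0 //.
have -> : 2 * lambda * (s / (2 * lambda * t) + (s / (2 * lambda * t))^-1) * t =
    s + (2 * lambda * t) ^+ 2 / s.
  by field; rewrite !gt_eqF.
rewrite lerD2l ler_pdivrMr //.
have : 2 * lambda * t <= 2 * lambda by rewrite ler_piMr // mulr_ge0 // ltW.
nra.
Qed.

Lemma cvg_sublinear (K c : R) :
  (K + c * Num.sqrt r) / r @[r --> +oo] --> (0 : R).
Proof.
have V0 : (r : R)^-1 @[r --> +oo] --> (0 : R).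
  apply/gtr0_cvgV0; last exact: cvg_id.
  by near=> r; near: r; exact: nbhs_pinfty_gt.
have S0 : Num.sqrt (r^-1) @[r --> +oo] --> (0 : R).
  by rewrite -sqrtr0; apply: continuous_cvg => //; exact: sqrt_continuous.
have -> : (0 : R) = K * 0 + c * 0 by rewrite !mulr0 addr0.
apply: (@cvg_trans _ ((K * r^-1 + c * Num.sqrt (r^-1)) @[r --> +oo])); last first.
  by apply: cvgD; apply: cvgMr.
apply: near_eq_cvg; near=> r.
have r0 : 0 < r by near: r; exact: nbhs_pinfty_gt.
rewrite mulrDl; congr (_ + _); rewrite -mulrA; congr (_ * _).
have sr0 : 0 < Num.sqrt r by rewrite sqrtr_gt0.
rewrite sqrtrV ?ltW // -[X in _ = _ / X](sqr_sqrtr (ltW r0)) expr2 invfM mulrA.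
by rewrite divff ?gt_eqF // mul1r.
Unshelve. all: by end_near. Qed.

Lemma ln_add_le_sqrt (r q : R) : 0 < r -> 0 <= q ->
  ln (r + q) <= 2 * (Num.sqrt r + Num.sqrt q).
Proof.
move=> r0 q0; have rq0 : 0 < r + q by rewrite ltr_wpDr.
rewrite -[in leLHS](sqr_sqrtr (ltW rq0)) lnXn ?sqrtr_gt0 // -[ln _ *+ 2]mulr_natl ler_pM2l //.
apply: (le_trans (ltW (ln_sublinear _))); first by rewrite sqrtr_gt0.
rewrite -ler_sqr ?nnegrE ?addr_ge0 ?sqrtr_ge0 // (sqr_sqrtr (ltW rq0)).
rewrite sqrrD (sqr_sqrtr (ltW r0)) (sqr_sqrtr q0) addrAC lerDl.
by rewrite mulrn_wge0 // mulr_ge0 ?sqrtr_ge0.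
Qed.

End Optimisation.

(** * The bound on the fluctuations of the bridge *)

Theorem theorem3p2 (R : realType)
  (j : int * int -> int * int -> R) (lambda : R)
  (hj : jump_intensity j) (hv : constant_speed j) (hlambda : 0 < lambda)
  (he : forall x : int * int,
     Phi j (e1 x) <= lambda ^+ 2 /\ Phi j (e2 x) <= lambda ^+ 2)
  (hf : forall x : int * int,
     Phi j (e2 x) * Phi j (e1 x) <= Phi j (face x)
       <= Phi j (e2 (x + v1)) * Phi j (e1 (x + v2)))
  (x : int * int) (d : measure_display) (Omega : measurableType d)
  (P : probability Omega R) (X : process R Omega)
  (hX : random_walk_from j x P X) (t : R) (ht : 0 < t < 1) :
  exists2 g : R -> R,
    g r / r @[r --> +oo] --> (0 : R) &
    forall r : R, 0 < r ->
      (lne (bridge P X x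
              [set w : Omega | (r <= dist_l1 (X t w) (mean (bridge P X x) X t))%R])
       <= (- 2 * r * ln r + (ln (4 * lambda ^+ 2 * t * (1 - t)) + 2) * r
           + g r)%:E)%E.
Proof.
have [v v0 hv'] := hv; have /andP[t0 t1] := ht.
set m := mean _ _ _; set L := ln _; pose c := dist_l1 x m.
have t1' : 0 < 1 - t by rewrite subr_gt0.
have c0 : 0 <= c by rewrite addr_ge0.
pose K := ln 4 + 8 * lambda - c * L + 4 * c * Num.sqrt (2 * lambda).
exists (fun r => K + 4 * c * Num.sqrt r); first exact: cvg_sublinear.
(* Tilting for the level s instead of r makes both tilts nonnegative for every
   r > 0, and changes the exponent by a bounded amount. *)
move=> r r0; pose s := r + 2 * lambda.
have ls : 2 * lambda <= s by rewrite lerDr ltW.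
have s0 : 0 < s by rewrite addr_gt0 ?mulr_gt0.
pose a := ln (s / (2 * lambda * t)); pose b := ln (s / (2 * lambda * (1 - t))).
have abE : a + b = 2 * ln s - L.
  rewrite /a /b /L !ln_div ?posrE ?mulr_gt0 //.
  have -> : 4 * lambda ^+ 2 * t * (1 - t) = (2 * lambda * t) * (2 * lambda * (1 - t)).
    by ring.
  by rewrite [X in _ = _ - X]lnM ?posrE ?mulr_gt0 //; ring.
have ab0 : 0 <= a + b.
  by apply: addr_ge0; apply: ln_ge0; rewrite ler_pdivlMr ?mulr_gt0 // mul1r;
    apply: le_trans ls; rewrite ler_piMr ?mulr_ge0 ?ltW //; lra.
have tail := @bridge_tail R j v lambda hj v0 hv' hlambda he hf x d Omega P X hX t ht
  (fun y => r <= dist_l1 y m) a b (r - c) ab0.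
have {tail} := tail _; set Q := bridge P X x _ => tail.
have {}tail : (Q <= (expR (ln 4 + (tilt lambda a * t + tilt lambda b * (1 - t) -
    (a + b) * (r - c))))%:E)%E.
  rewrite expRD lnK ?posrE //; apply: tail => y ry.
  have [e he'] := dist_l1_signed x y m; exists e.
  by apply: le_trans he'; rewrite lerB.
apply: (@le_trans _ _ (ln 4 + (tilt lambda a * t + tilt lambda b * (1 - t) -
    (a + b) * (r - c)))%:E).
  rewrite -[X in (_ <= X)%E](@expeRK R) lee_lne //=.
  - by rewrite in_itv /= measure_ge0 leey.
  - by rewrite in_itv /= lee_fin expR_ge0 leey.
rewrite lee_fin.
have ta : tilt lambda a * t <= s + 2 * lambda by apply: tilt_ln_le; rewrite ?t0 ?(ltW t1).
have tb : tilt lambda b * (1 - t) <= s + 2 * lambda.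
  by apply: tilt_ln_le; rewrite ?t1' //= lerBlDr lerDl ltW.
have lnrs : r * ln r <= r * ln s.
  by rewrite ler_pM2l // ler_ln ?posrE // lerDl mulr_ge0 ?ltW.
have lns : ln s <= 2 * (Num.sqrt r + Num.sqrt (2 * lambda)).
  by apply: ln_add_le_sqrt => //; rewrite mulr_ge0 // ltW.
have clns := ler_wpM2l c0 lns.
rewrite abE /K /s in ta tb *.
nra.
Qed.
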